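(* $V_7 = 34.6494874$.
   Context: For an integer $n\ge 2$, $C_n$ denotes the set of real cosine polynomials $f(\phi)=\sum_{k=0}^{n} a_k\cos(k\phi)$ such that (i) all coefficients $a_0,\dots,a_n$ are real and nonnegative, (ii) $a_1>a_0>0$, and (iii) $f(\phi)\ge 0$ for all real $\phi$. For $f\in C_n$ put $v(f)=\dfrac{f(0)-a_0}{(\sqrt{a_1}-\sqrt{a_0})^2}$, and define $V_n=\inf_{f\in C_n} v(f)$. Numerical constants are decimal values as given in the paper, to seven decimal places. *)

(* Defs.v *)
From Stdlib Require Import Reals.
From Coquelicot Require Import Coquelicot.

Open Scope R_scope.

(* A cosine polynomial of degree at most n is represented by its coefficient
   sequence a, of which only a 0, ..., a n matter. *)
Definition cospoly (n : nat) (a : nat -> R) (phi : R) : R :=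
  sum_f_R0 (fun k => a k * cos (INR k * phi)) n.

Definition C_ (n : nat) (a : nat -> R) : Prop :=
  (forall k : nat, (k <= n)%nat -> 0 <= a k) /\
  0 < a 0%nat < a 1%nat /\
  (forall phi : R, 0 <= cospoly n a phi).

Definition v (n : nat) (a : nat -> R) : R :=
  (cospoly n a 0 - a 0%nat) / (sqrt (a 1%nat) - sqrt (a 0%nat)) ^ 2.

(* [real] sends infinite values to 0; for n >= 2 the infimum is finite, since
   C_ n is nonempty and v is nonnegative on it. *)
Definition V (n : nat) : R :=
  real (Glb_Rbar (fun y => exists a : nat -> R, C_ n a /\ y = v n a)).

(* Main.v *)
(** For t = sqrt (a_1 / a_0) fixed, minimising a_1 + ... + a_7 is a linear
    programme in the remaining coefficients. Its dual solutions are weighted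
    nodes (w, x) with x = cos phi: summing w f(phi) >= 0 gives a lower bound
    B a_1 - W a_0 as soon as every moment of order 2, ..., 7 is at most 1.
    This proves v f >= c wherever the quadratic B t^2 - W - c (t - 1)^2 is
    nonnegative. Near the optimum t = 1.31092 the bound has to be almost exact,
    but farther away the slack grows quadratically, so ten rational
    solutions cover all t > 1. The upper bound comes from one polynomial, a
    nonnegative product in cos phi up to a remainder that its constant term
    absorbs. *)

Require Import Defs.
From Stdlib Require Import Reals List Lra Lia.
From Coquelicot Require Import Coquelicot.
Import ListNotations.
Open Scope R_scope.

Fixpoint cheb (k : nat) (x : R) : R :=
  match k with
  | O => 1
  | S j => match j with
           | O => x
           | S i => 2 * x * cheb j x - cheb i x
           end
  end.

Lemma cheb_SS (k : nat) (x : R) :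
  cheb (S (S k)) x = 2 * x * cheb (S k) x - cheb k x.
Proof. reflexivity. Qed.

Lemma cos_INR_mult (k : nat) (t : R) : cos (INR k * t) = cheb k (cos t).
Proof.
  enough (cos (INR k * t) = cheb k (cos t) /\
          cos (INR (S k) * t) = cheb (S k) (cos t)) by tauto.
  induction k as [|k [IH1 IH2]].
  - split.
    + simpl; rewrite Rmult_0_l; apply cos_0.
    + simpl; f_equal; ring.
  - split; [exact IH2|].
    rewrite cheb_SS, <- IH1, <- IH2.
    replace (INR (S (S k)) * t) with (INR (S k) * t + t)
      by (rewrite !S_INR; ring).
    replace (INR k * t) with (INR (S k) * t - t) by (rewrite S_INR; ring).
    rewrite cos_plus, cos_minus; ring.
Qed.

Lemma cospoly_cheb (n : nat) (a : nat -> R) (phi : R) :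
  cospoly n a phi = sum_f_R0 (fun k => a k * cheb k (cos phi)) n.
Proof.
  apply sum_eq; intros k _; now rewrite cos_INR_mult.
Qed.

Lemma cospoly_0 (n : nat) (a : nat -> R) : cospoly n a 0 = sum_f_R0 a n.
Proof.
  apply sum_eq; intros k _; now rewrite Rmult_0_r, cos_0, Rmult_1_r.
Qed.

(** A pair [(w, x)] is a node [x] with weight [w]. *)
Definition moment (l : list (R * R)) (k : nat) : R :=
  fold_right (fun p s => fst p * cheb k (snd p) + s) 0 l.

Definition nodes (l : list (R * R)) : Prop :=
  List.Forall (fun p => 0 <= fst p /\ -1 <= snd p <= 1) l.

Lemma sum_moment_ge_0 (n : nat) (a : nat -> R) (l : list (R * R)) :
  C_ n a -> nodes l -> 0 <= sum_f_R0 (fun k => a k * moment l k) n.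
Proof.
  intros (_ & _ & Hf) Hl.
  induction Hl as [|[w x] l [Hw Hx] Hl IH]; simpl in *.
  - apply cond_pos_sum; intros k; rewrite Rmult_0_r; apply Rle_refl.
  - rewrite (sum_eq _ (fun k => a k * cheb k x * w + a k * moment l k) n)
      by (intros k _; unfold moment; ring).
    rewrite sum_plus, <- scal_sum.
    apply Rplus_le_le_0_compat; [|exact IH].
    apply Rmult_le_pos; [exact Hw|].
    rewrite <- (cos_acos x Hx), <- cospoly_cheb; apply Hf.
Qed.

Lemma sum_ge_first_two (f : nat -> R) (n : nat) :
  (forall k, (2 <= k <= S n)%nat -> 0 <= f k) ->
  f 0%nat + f 1%nat <= sum_f_R0 f (S n).
Proof.
  induction n as [|n IH]; intros Hf; [simpl; apply Rle_refl|].
  rewrite tech5.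
  assert (0 <= f (S (S n))) by (apply Hf; lia).
  assert (f 0%nat + f 1%nat <= sum_f_R0 f (S n))
    by (apply IH; intros k Hk; apply Hf; lia).
  lra.
Qed.

Lemma moment_0_1_bound (n : nat) (a : nat -> R) (l : list (R * R)) :
  C_ (S n) a -> nodes l ->
  (forall k, (2 <= k <= S n)%nat -> moment l k <= 1) ->
  (1 - moment l 1) * a 1%nat - moment l 0 * a 0%nat
    <= cospoly (S n) a 0 - a 0%nat.
Proof.
  intros Ha Hl Hm.
  pose proof (sum_moment_ge_0 _ _ _ Ha Hl) as Hs.
  destruct Ha as (Hpos & _ & _).
  pose proof (sum_ge_first_two (fun k => a k - a k * moment l k) n) as H2.
  rewrite minus_sum, <- cospoly_0 in H2.
  enough (forall k, (2 <= k <= S n)%nat -> 0 <= a k - a k * moment l k)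
    by (specialize (H2 H); lra).
  intros k Hk.
  pose proof (Hpos k ltac:(lia)); pose proof (Hm k Hk); nra.
Qed.

Section RatioIntervals.

Variables (n : nat) (a : nat -> R) (l : list (R * R)) (c lo : R).
Hypothesis Ha : C_ (S n) a.
Hypothesis Hl : nodes l.
Hypothesis Hm : forall k, (2 <= k <= S n)%nat -> moment l k <= 1.

Let t : R := sqrt (a 1%nat) / sqrt (a 0%nat).
Let gap (s : R) : R := (1 - moment l 1) * s ^ 2 - moment l 0 - c * (s - 1) ^ 2.

(** Everything is homogeneous in a_0 and a_1; factoring out a_0 leaves a quadratic in [t] alone. *)
Lemma v_lower_bound_of_gap : 0 <= gap t -> c <= v (S n) a.
Proof.
  intros Hgap.
  pose proof (moment_0_1_bound _ _ _ Ha Hl Hm) as Hb.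
  destruct Ha as (_ & [H0 H1] & _).
  assert (Hp : 0 < sqrt (a 0%nat)) by now apply sqrt_lt_R0.
  assert (Hpq : sqrt (a 0%nat) < sqrt (a 1%nat)) by (apply sqrt_lt_1; lra).
  unfold v; apply Rle_div_r; [apply pow_lt; lra|].
  apply Rle_trans with (2 := Hb).
  rewrite <- (sqrt_sqrt (a 0%nat)) at 2 by lra.
  rewrite <- (sqrt_sqrt (a 1%nat)) at 2 by lra.
  assert (Hq : sqrt (a 1%nat) = t * sqrt (a 0%nat)) by (unfold t; field; lra).
  rewrite Hq.
  assert (0 <= gap t * sqrt (a 0%nat) ^ 2)
    by (apply Rmult_le_pos; [|apply pow_le]; lra).
  unfold gap in *; lra.
Qed.

(** Here [gap] has leading coefficient at most 0, so it is concave and its endpoint values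
    suffice. *)
Lemma v_lower_bound_between (hi : R) :
  1 - moment l 1 <= c -> lo < hi -> 0 <= gap lo -> 0 <= gap hi ->
  lo <= t <= hi -> c <= v (S n) a.
Proof.
  intros HV Hlh Hglo Hghi Ht; apply v_lower_bound_of_gap.
  apply Rmult_le_reg_l with (hi - lo); [lra|].
  replace ((hi - lo) * gap t) with
    ((hi - t) * gap lo + (t - lo) * gap hi
     + (c - (1 - moment l 1)) * ((hi - lo) * ((t - lo) * (hi - t))))
    by (unfold gap; ring).
  rewrite Rmult_0_r.
  repeat first [lra | apply Rplus_le_le_0_compat | apply Rmult_le_pos].
Qed.

(** Here the leading coefficient is nonnegative and [gap] is nondecreasing on the positive axis. *)
Lemma v_lower_bound_above :
  0 <= c <= 1 - moment l 1 -> 0 <= lo -> 0 <= gap lo -> lo <= t ->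
  c <= v (S n) a.
Proof.
  intros HV Hlo Hglo Ht; apply v_lower_bound_of_gap.
  replace (gap t) with
    (gap lo + (t - lo) * ((1 - moment l 1 - c) * (t + lo) + 2 * c))
    by (unfold gap; ring).
  repeat first [lra | apply Rplus_le_le_0_compat | apply Rmult_le_pos].
Qed.

End RatioIntervals.

Ltac solve_nodes :=
  unfold nodes; repeat (apply Forall_cons; [simpl; lra|]); apply Forall_nil.

Ltac solve_moments :=
  let k := fresh "k" in let Hk := fresh "Hk" in
  intros k Hk;
  assert (k = 2 \/ k = 3 \/ k = 4 \/ k = 5 \/ k = 6 \/ k = 7)%nat
    as [-> | [-> | [-> | [-> | [-> | ->]]]]] by lia;
  clear; unfold moment; simpl; lra.

Ltac between lst lower upper :=
  apply (v_lower_bound_between _ _ lst _ lower) with (hi := upper);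
  [assumption | solve_nodes | solve_moments
  | unfold moment; simpl; lra .. | split; assumption].

(** The constant exceeds 34.6494874 - 5e-8 by 5e-9, because the infimum inherits only a weak
    inequality while the final one is strict. *)
Lemma v7_lower_bound (a : nat -> R) : C_ 7 a -> 34.649487355 <= v 7 a.
Proof.
  intros Ha.
  set (t := sqrt (a 1%nat) / sqrt (a 0%nat)).
  assert (H1 : 1 <= t).
  { destruct Ha as (_ & [Ha0 Ha1] & _).
    apply Rle_div_r; [now apply sqrt_lt_R0|].
    rewrite Rmult_1_l; apply sqrt_le_1; lra. }
  destruct (Rle_lt_dec t 1.24) as [H2|H2%Rlt_le].
  { between [(1, -1)] 1 1.24. }
  destruct (Rle_lt_dec t 1.304) as [H3|H3%Rlt_le].
  { between [(2.6, -1); (3.21, -0.809); (3.21, -0.309)] 1.24 1.304. }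
  destruct (Rle_lt_dec t 1.3106) as [H4|H4%Rlt_le].
  { between [(2.8287, -1); (4.3146, -0.79283); (3.3066, -0.23601)]
      1.304 1.3106. }
  destruct (Rle_lt_dec t 1.31088) as [H5|H5%Rlt_le].
  { between [(2.867776, -1); (4.525932, -0.7918504); (3.354761, -0.224165)]
      1.3106 1.31088. }
  destruct (Rle_lt_dec t 1.310915) as [H6|H6%Rlt_le].
  { between [(2.87082565, -1); (4.54239912, -0.79179037);
             (3.35886726, -0.22327481)] 1.31088 1.310915. }
  destruct (Rle_lt_dec t 1.310925) as [H7|H7%Rlt_le].
  (* This interval contains t = 1.31092. By complementary slackness the nodes lie close to the zeros
     of the optimal polynomial. *)
  { between [(2.870965436, -1); (4.543154126, -0.791787672);
             (3.359056684, -0.223234108)] 1.310915 1.310925. }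
  destruct (Rle_lt_dec t 1.31108) as [H8|H8%Rlt_le].
  { between [(2.8713501, -1); (4.54523109, -0.79178026);
             (3.35957819, -0.22312218)] 1.310925 1.31108. }
  destruct (Rle_lt_dec t 1.317) as [H9|H9%Rlt_le].
  { between [(2.88545, -1); (4.62136, -0.791531); (3.3792, -0.219069)]
      1.31108 1.317. }
  destruct (Rle_lt_dec t 1.4) as [H10|H10%Rlt_le].
  { between [(3.34, -1); (6.99, -0.793); (4.3, -0.131)] 1.317 1.4. }
  (* These weights make the leading coefficient of [gap] positive, about 0.05, so no upper endpoint
     is needed. *)
  apply (v_lower_bound_above _ _
    [(13.5, -1); (23.79, -0.788); (15.65, -0.248); (6.38, 0.38)] _ 1.4);
  [assumption | solve_nodes | solve_moments
  | unfold moment; simpl; lra .. | assumption].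
Qed.

(** Scaled to a_0 = 1, with a_1 a rational square so that [v] is rational. Orders 5 and 6, where the
    dual moments near the optimum stay below 1, get coefficient 0. *)
Definition near_optimum (k : nat) : R :=
  nth k [1; 1.310920 ^ 2; 1.07310768285; 0.45273359598; 0.10169688448; 0; 0;
         0.00355972474] 0.

Lemma near_optimum_ge_0 (phi : R) : 0 <= cospoly 7 near_optimum phi.
Proof.
  assert (Hb : forall k, -1 <= cheb k (cos phi) <= 1)
    by (intros k; rewrite <- cos_INR_mult; apply COS_bound).
  rewrite cospoly_cheb.
  set (x := cos phi) in *.
  (* The product is the Chebyshev expansion of [near_optimum] with 2e-10 removed
     from the constant term, up to errors below 2e-11 in the coefficients. *)
  assert (Hprod : 0 <= 0.22782238354 * (1 + x) *
    ((x + 0.79178247547) * (x + 0.22322064004)) ^ 2 *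
    ((x - 1.51500311551) ^ 2 + 1.721981382615)).
  { assert (0 <= 1 + x) by (specialize (Hb 1%nat); simpl in Hb; lra).
    pose proof (pow2_ge_0 (x - 1.51500311551)).
    repeat first [lra | apply pow2_ge_0 | apply Rmult_le_pos]. }
  (* As |T_k| <= 1, the eight coefficient errors total less than 1.6e-10, within the 2e-10 set
     aside. *)
  pose proof (Hb 1%nat); pose proof (Hb 2%nat); pose proof (Hb 3%nat).
  pose proof (Hb 4%nat); pose proof (Hb 5%nat); pose proof (Hb 6%nat).
  pose proof (Hb 7%nat).
  unfold near_optimum; simpl in *; lra.
Qed.

Lemma near_optimum_C : C_ 7 near_optimum.
Proof.
  split; [|split; [|exact near_optimum_ge_0]].
  - intros k Hk; unfold near_optimum.
    do 8 (destruct k as [|k]; [simpl; lra|]); lia.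
  - unfold near_optimum; simpl; lra.
Qed.

Lemma v7_near_optimum : v 7 near_optimum < 34.64948745.
Proof.
  unfold v; rewrite cospoly_0.
  unfold near_optimum; cbn [nth].
  rewrite sqrt_1, sqrt_pow2 by lra.
  apply Rlt_div_l; simpl; lra.
Qed.

(* 34.6494874 is V 7 rounded to seven decimal places *)
Theorem theorem1p1 : Rabs (V 7 - 34.6494874) < 0.00000005.
Proof.
  unfold V.
  set (E := fun y => exists a : nat -> R, C_ 7 a /\ y = v 7 a).
  destruct (Glb_Rbar_correct E) as [Hlb Hglb].
  assert (Hlo : Rbar_le 34.649487355 (Glb_Rbar E)).
  { apply Hglb; intros y (a & Ha & ->); now apply v7_lower_bound. }
  assert (Hhi : Rbar_le (Glb_Rbar E) (v 7 near_optimum)).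
  { apply Hlb; exists near_optimum; split; [apply near_optimum_C|reflexivity]. }
  pose proof v7_near_optimum.
  (* The two finite bounds exclude the infinite values, which [real] would send to 0. *)
  destruct (Glb_Rbar E) as [g| |]; simpl in *; try easy.
  apply Rabs_def1; lra.
Qed.
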